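(* Let $\alpha\in\mathbb N$ and $k\in\mathbb Z_+$, and let $d\in\mathbb Z_+$ be fixed with $(p,d)=1$. Let $\mu_{k,q}^{(\alpha)}$ be given by $$\mu_{k,q}^{(\alpha)}(a+dp^N\mathbb Z_p)=\frac{[dp^N]_{q^\alpha}^k}{[dp^N]_q}\,q^a\,\widetilde\beta_{k,q^{dp^N}}^{(\alpha)}\left(\frac{a}{dp^N}\right)$$ for $N\in\mathbb Z_+$ and integers $0\le a<dp^N$. Then $\mu_{k,q}^{(\alpha)}$ extends to a $\mathbb Q(q)$-valued distribution on the compact open sets $U\subset X$.
   Context: $p$ is a fixed prime; $\mathbb C_p$ is the completion of an algebraic closure of $\mathbb Q_p$, with $|p|_p=1/p$. $\mathbb N$ is the set of positive integers, $\mathbb Z_+=\mathbb N\cup\{0\}$. $q\in\mathbb C_p$ satisfies $|1-q|_p<1$. $[x]_Q=\frac{1-Q^x}{1-Q}$ (so that $\lim_{Q\to1}[x]_Q=x$), and $[x]_Q^k$ means $([x]_Q)^k$. $\mathbb Q(q)$ is the field generated by $q$ over $\mathbb Q$. $X=X_d=\varprojlim_N(\mathbb Z/dp^N\mathbb Z)$, and $a+dp^N\mathbb Z_p$ denotes the set $\{x\in X: x\equiv a \pmod{dp^N}\}$, for $a\in\mathbb Z$, $0\le a<dp^N$. A distribution on $X$ is an additive map on compact open subsets: $\mu(\bigcup_{i=1}^m U_i)=\sum_{i=1}^m\mu(U_i)$ for disjoint compact open $U_i\subset X$. The $q$-Bernoulli numbers with weight $\alpha$, $\widetilde\beta_{n,q}^{(\alpha)}$,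 are defined recursively by $\widetilde\beta_{0,q}^{(\alpha)}=1$ and, for $n\ge1$, $q\,(q^\alpha\widetilde\beta^{(\alpha)}+1)^n-\widetilde\beta_{n,q}^{(\alpha)}=\frac{\alpha}{[\alpha]_q}$ if $n=1$ and $=0$ if $n>1$, where after binomial expansion $(\widetilde\beta^{(\alpha)})^l$ is replaced by $\widetilde\beta_{l,q}^{(\alpha)}$. The $q$-Bernoulli polynomials with weight $\alpha$ are $\widetilde\beta_{n,q}^{(\alpha)}(x)=\sum_{l=0}^n\binom nl[x]_{q^\alpha}^{n-l}q^{\alpha l x}\,\widetilde\beta_{l,q}^{(\alpha)}$. Replacing $q$ by $q^M$ gives $\widetilde\beta_{n,q^M}^{(\alpha)}(x)$; at $x=a/M$ one takes $(q^M)^{a/M}=q^a$. *)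

(* Defs.v *)
(* MathComp / MathComp-Analysis *)
From HB Require Import structures.
From mathcomp Require Import all_boot all_order all_algebra.
From mathcomp Require Import all_classical all_reals all_analysis.

Set Implicit Arguments.
Unset Strict Implicit.
Unset Printing Implicit Defensive.

Import Order.TTheory GRing.Theory Num.Theory.

Local Open Scope classical_set_scope.
Local Open Scope ring_scope.

Section AbsoluteValues.
Variable R : realType.

Definition is_absolute_value (F : fieldType) (v : F -> R) : Prop :=
  [/\ forall x, 0 <= v x,
      forall x, v x = 0 <-> x = 0,
      forall x y, v (x * y) = v x * v y &
      forall x y, v (x + y) <= Num.max (v x) (v y)].

Definition is_complete (F : fieldType) (v : F -> R) : Prop :=
  forall u : nat -> F,
    (forall e, 0 < e -> exists N : nat, forall m n : nat,
       (N <= m)%N -> (N <= n)%N -> v (u m - u n) < e) ->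
    exists l, forall e, 0 < e -> exists N : nat, forall n : nat,
       (N <= n)%N -> v (u n - l) < e.

Definition is_completion (F K : fieldType) (v : F -> R) (w : K -> R)
    (i : {rmorphism F -> K}) : Prop :=
  [/\ is_absolute_value w,
      is_complete w,
      forall x, w (i x) = v x &
      forall y e, 0 < e -> exists x, w (y - i x) < e].

Definition is_algebraic_closure (F L : fieldType) (i : {rmorphism F -> L}) :
    Prop :=
  GRing.closed_field_axiom L /\ forall y : L, algebraicOver i y.

(* `|p|_p = 1/p` *)
Definition padic_abs (p : nat) (x : rat) : R :=
  if x == 0 then 0
  else p%:R ^+ logn p `|denq x| / p%:R ^+ logn p `|numq x|.

(* (K, w) is C_p: vL is the extension to Qpbar of the p-adic absolute value. *)
Definition is_Cp (p : nat) (K : fieldType) (w : K -> R) : Prop :=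
  exists (Qp : fieldType) (vQp : Qp -> R) (i : {rmorphism rat -> Qp})
         (Qpbar : fieldType) (vL : Qpbar -> R) (j : {rmorphism Qp -> Qpbar})
         (h : {rmorphism Qpbar -> K}),
    [/\ is_completion (padic_abs p) vQp i,
        is_algebraic_closure j,
        is_absolute_value vL,
        forall x, vL (j x) = vQp x &
        is_completion vL w h].

End AbsoluteValues.

(* The field generated by q over the rationals. *)
Definition rat_adjoin (K : fieldType) (q : K) : set K :=
  [set z | forall S : {pred K}, GRing.divring_closed S ->
     (forall r : rat, ratr r \in S) -> q \in S -> z \in S].

Section QBernoulli.
Variable K : fieldType.

(* [x]_Q = (1 - Q^x) / (1 - Q), with value x (the limit) at Q = 1. For x not a
   natural number the power Q^x has no meaning in a bare field, so it is passed
   separately as Qx. *)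
Definition qnum (Q Qx x : K) : K :=
  if Q == 1 then x else (1 - Qx) / (1 - Q).

Definition qnat (Q : K) (n : nat) : K := qnum Q (Q ^+ n) n%:R.

Definition qBernoulli_rec (alpha : nat) (q : K) (b : nat -> K) : Prop :=
  b 0%N = 1 /\
  forall n : nat, (0 < n)%N ->
    q * (\sum_(l < n.+1) 'C(n, l)%:R * q ^+ (alpha * l) * b l) - b n =
    if n == 1%N then alpha%:R / qnat q alpha else 0.

(* The recursion has exactly one solution if alpha > 0, K has characteristic 0 and q is
   either 1 or not a root of unity. For q = 1 it is the relation of index n + 1,
   not that of index n, which determines the n-th term. *)
Definition qBernoulli (alpha : nat) (q : K) : nat -> K :=
  xget (fun=> 0) [set b | qBernoulli_rec alpha q b].

(* As in qnum, qx is the value given to q^x. *)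
Definition qBernoulli_poly (alpha : nat) (q : K) (n : nat) (qx x : K) : K :=
  \sum_(l < n.+1) 'C(n, l)%:R * qnum (q ^+ alpha) (qx ^+ alpha) x ^+ (n - l)
    * qx ^+ (alpha * l) * qBernoulli alpha q l.

(* (q ^ M) ^ (a / M) = q ^ a, where M = d * p ^ N. *)
Definition mu_ball (p d alpha k : nat) (q : K) (N a : nat) : K :=
  let M := (d * p ^ N)%N in
  qnat (q ^+ alpha) M ^+ k / qnat q M * q ^+ a *
  qBernoulli_poly alpha (q ^+ M) k (q ^+ a) (a%:R / M%:R).

End QBernoulli.

(* The inverse limit of the discrete rings Z / d p^N, each represented by its
   residues 0, ..., d p^N - 1, with the topology induced by the product. *)
Definition X (p d : nat) :
    set (prod_topology (fun N => discrete_topology 'I_(d * p ^ N))) :=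
  [set x : prod_topology (fun N => discrete_topology 'I_(d * p ^ N)) |
    forall N, ((x N.+1 : 'I_(d * p ^ N.+1)) %% (d * p ^ N))%N =
              (x N : 'I_(d * p ^ N)) :> nat].
Arguments X : clear implicits.

Definition Xball (p d N a : nat) : set (X p d) :=
  [set x : X p d | (set_val x N : 'I_(d * p ^ N)) = a :> nat].
Arguments Xball : clear implicits.

Definition is_compact_open (T : topologicalType) (U : set T) : Prop :=
  compact U /\ open U.

(* Values of mu outside the compact open sets are irrelevant. *)
Definition is_distribution (T : topologicalType) (V : nmodType)
    (mu : set T -> V) : Prop :=
  forall (m : nat) (U : 'I_m -> set T),
    (forall i, is_compact_open (U i)) -> trivIset setT U ->
    mu (\bigcup_i U i) = \sum_(i < m) mu (U i).

(* Main.v *)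
Require Import Defs.
From HB Require Import structures.
From mathcomp Require Import all_boot all_order all_algebra.
From mathcomp Require Import all_classical all_reals all_analysis.
From mathcomp Require Import ring.

Set Implicit Arguments.
Unset Strict Implicit.
Unset Printing Implicit Defensive.

Import Order.TTheory GRing.Theory Num.Theory.

Local Open Scope classical_set_scope.
Local Open Scope ring_scope.

(** Write [Q = q ^ alpha] and let [U_q] be the linear functional on polynomials
    that sends [X ^ l] to the [l]-th weighted q-Bernoulli number (the umbral
    evaluation, here [moment (qBernoulli alpha q)]). The recursion of these
    numbers says exactly that, for every polynomial [P],

      U_q (q P(Q X + 1) - P(X)) = (q - 1) P(0) + alpha / [alpha]_q P'(0),

    and the prescribed value on the ball [a + m Z_p], with [m = d p ^ N], is

      q ^ a / [m]_q * U_(q ^ m) (([a]_Q + Q ^ a [m]_Q X) ^ k).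

    The operator [P |-> q P(Q X + 1) - P(X)] is onto when [q] is either 1 or not
    a root of unity, in characteristic 0 ([qshift_surj]); hence the identity
    above determines [U_q]. The average

      V(P) = 1 / [n]_q * sum_(i < n) q ^ i U_(q ^ n) (P([i]_Q + Q ^ i [n]_Q X))

    satisfies the same identity, because its left-hand side telescopes in [i].
    So [V = U_q] ([qBernoulli_multiplication]), and for [q ^ m] in place of [q]
    and [n = p] this is the statement that the value on a ball is the sum of the
    values on the [p] balls of the next level ([mu_ball_split]).

    That [q] is 1 or not a root of unity comes from [|1 - q| < 1]: a root of
    unity of order prime to [p] in the residue disc of 1 is 1, so a root of
    unity [q <> 1] would have [p]-power order and some denominator
    [[d p ^ N]_q] would vanish ([one_or_nonroot_near1]).

    To pass from balls to compact open sets, a compact open [U] is a union of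
    balls of one level [N] ([compact_open_saturated]). Thus the Riemann sums of
    the ball values at the integers [a < d p ^ N] lying in [U] are constant
    from the level [N] on, by [mu_ball_split], and their eventual value is
    additive in [U]. It is a finite sum of ball values, which lie in every
    subfield that contains [q] ([mu_ball_rational]). *)

(** * Compact open sets of the inverse limit *)

Lemma cvg_prod_discrete (T : nat -> choiceType)
    (x : prod_topology (fun n => discrete_topology (T n)))
    (y : nat -> prod_topology (fun n => discrete_topology (T n))) :
  (forall n, \forall m \near \oo, y m n = x n) -> y m @[m --> \oo] --> x.
Proof.
move=> yx; apply/cvg_sup => n U [_ [[B oB <-] /= Bx sBU]].
apply: filterS (yx n) => m yxm; apply: sBU.
by rewrite /preimage /= /proj yxm.
Qed.

Lemma X_le_level p d (x y : X p d) N n : (n <= N)%N ->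
  set_val x N = set_val y N -> set_val x n = set_val y n.
Proof.
move=> /subnK <-; elim: (N - n)%N => [//|i IH] /= e; apply: IH.
have /set_mem/(_ (i + n)%N) xE := valP x.
have /set_mem/(_ (i + n)%N) yE := valP y.
apply: val_inj; rewrite -[LHS]xE -[RHS]yE.
by congr (_ %% _)%N; congr (nat_of_ord _).
Qed.

(** If no ball around [x] lay in [U], each level [N] would have a point that
    agrees with [x] up to [N] and lies outside [U]; these points converge to [x]
    in every coordinate, hence in the product topology, and so enter the open
    set [U]. *)
Lemma open_ball_sub p d (U : set (X p d)) (x : X p d) : open U -> U x ->
  exists N, forall y : X p d, set_val y N = set_val x N -> U y.
Proof.
move=> oU Ux; apply: contrapT => noN.
have /choice[y yP] : forall N, exists y : X p d,
    set_val y N = set_val x N /\ ~ U y.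
  move=> N; apply: contrapT => noy; apply: noN; exists N => y yx.
  by apply: contrapT => nUy; apply: noy; exists y.
case: oU => V oV VU.
have : set_val (y m) @[m --> \oo] --> set_val x.
  apply: cvg_prod_discrete => n; exists n => // m /= nm.
  exact: (X_le_level nm (yP m).1).
move=> /(_ V) []; first by apply: open_nbhs_nbhs; split=> //; rewrite -VU in Ux.
move=> m _ /(_ m (leqnn m)) /= Vy.
by apply: (yP m).2; rewrite -VU.
Qed.

Lemma agree_nbhs p d (x : X p d) N :
  nbhs x [set y : X p d | set_val y N = set_val x N].
Proof.
pose A := [set z : prod_topology (fun n => discrete_topology 'I_(d * p ^ n)) |
  z N = set_val x N].
have : nbhs (set_val x) A.
  have := @proj_continuous _ (fun n => discrete_topology 'I_(d * p ^ n)) N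
    (set_val x) [set set_val x N].
  by apply; exact: discrete_set1.
exact: (@initial_continuous _ _ set_val x A).
Qed.

Definition saturated p d N (U : set (X p d)) : Prop :=
  forall x y : X p d, set_val x N = set_val y N -> U x <-> U y.

Lemma saturated_le p d N N' (U : set (X p d)) : (N <= N')%N ->
  saturated N U -> saturated N' U.
Proof. by move=> NN' sU x y xy; apply: sU; exact: X_le_level NN' xy. Qed.

(** Each point of [U] has a ball inside [U]; compactness, used in the form that
    an eventual property which is locally uniform is uniform, yields one radius
    for all points, and then membership in [U] depends on the residue alone. *)
Lemma compact_open_saturated p d (U : set (X p d)) : is_compact_open U ->
  exists N, saturated N U.
Proof.
move=> [/compact_near_coveringP cU oU].
have [N _ /(_ N (leqnn N)) NP] : \forall N \near \oo,
    U `<=` (fun x => forall y : X p d, set_val y N = set_val x N -> U y).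
  apply: cU => x Ux; have [N NP] := open_ball_sub oU Ux.
  exists ([set y : X p d | set_val y N = set_val x N], [set m | (N <= m)%N]).
    split=> /=; last by exists N.
    exact: agree_nbhs.
  case=> /= y m [yx Nm] z zy.
  by apply: NP; rewrite -yx; apply: X_le_level Nm zy.
by exists N => x y xy; split=> [Ux|Uy]; [apply: NP Ux _ _|apply: NP Uy _ _].
Qed.

(** * Distributions from Riemann sums *)

Lemma level_gt0 p d N : (0 < d)%N -> (0 < p)%N -> (0 < d * p ^ N)%N.
Proof. by move=> d0 p0; rewrite muln_gt0 d0 expn_gt0 p0. Qed.

Definition residues p d (d_gt0 : (0 < d)%N) (p_gt0 : (0 < p)%N) (a : nat) :
    prod_topology (fun N => discrete_topology 'I_(d * p ^ N)) :=
  fun N => Ordinal (ltn_pmod a (level_gt0 N d_gt0 p_gt0)).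

Lemma residues_in_X p d (d_gt0 : (0 < d)%N) (p_gt0 : (0 < p)%N) a :
  X p d (residues d_gt0 p_gt0 a).
Proof. by move=> N /=; rewrite modn_dvdm // dvdn_mul // dvdn_exp2l. Qed.

Definition nat_in_X p d (d_gt0 : (0 < d)%N) (p_gt0 : (0 < p)%N) (a : nat) :
    X p d :=
  SigSub (mem_set (residues_in_X d_gt0 p_gt0 a)).

Lemma nat_in_XE p d (d_gt0 : (0 < d)%N) (p_gt0 : (0 < p)%N) a N :
  (set_val (nat_in_X d_gt0 p_gt0 a) N : 'I_(d * p ^ N)) = (a %% (d * p ^ N))%N
    :> nat.
Proof. by rewrite set_valE. Qed.

Section RiemannSums.
Variables (p d : nat) (p_gt0 : (0 < p)%N) (d_gt0 : (0 < d)%N).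
Variables (V : nmodType) (f : nat -> nat -> V).

Let M N := (d * p ^ N)%N.
Let pt := nat_in_X d_gt0 p_gt0.

Definition riemann_sum N (U : set (X p d)) : V :=
  \sum_(0 <= a < M N | `[< U (pt a) >]) f N a.

Hypothesis f_split : forall N a, (a < M N)%N ->
  f N a = \sum_(0 <= i < p) f N.+1 (a + i * M N).

(** The integers below [d p ^ N.+1] are the [a + i d p ^ N] with
    [a < d p ^ N] and [i < p]; all those over one [a] lie in [U] or none does. *)
Lemma riemann_sum_refine N U : saturated N U ->
  riemann_sum N.+1 U = riemann_sum N U.
Proof.
move=> satU; rewrite /riemann_sum big_mkcond /=.
have -> : M N.+1 = (p * M N)%N by rewrite /M expnS mulnCA.
rewrite big_nat_mul /=.
under eq_bigr => i _.
  rewrite -{1}[(i * M N)%N]add0n big_addn mulSn addnK.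
  over.
rewrite exchange_big_nat /= [RHS]big_mkcond /=.
apply: eq_big_nat => a /andP[_ aM].
have ptE i : `[< U (pt (a + i * M N)) >] = `[< U (pt a) >].
  apply: asbool_equiv_eq; apply: satU; apply: ord_inj.
  by rewrite !nat_in_XE addnC modnMDl.
under eq_bigr => i _ do rewrite ptE.
by case: ifP => _; [rewrite -f_split | rewrite big1].
Qed.

Definition riemann_limit (U : set (X p d)) : V :=
  xget 0 [set v | exists N0, forall N, (N0 <= N)%N -> riemann_sum N U = v].

Lemma riemann_limitE N0 U v :
  (forall N, (N0 <= N)%N -> riemann_sum N U = v) -> riemann_limit U = v.
Proof.
move=> vP; apply: xget_unique; first by exists N0.
move=> w [N1 wP]; rewrite -(wP (maxn N0 N1)) ?leq_maxr//.
by rewrite (vP (maxn N0 N1)) ?leq_maxl.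
Qed.

Lemma riemann_limit_saturated N U : saturated N U ->
  riemann_limit U = riemann_sum N U.
Proof.
move=> sU; apply: (@riemann_limitE N) => N' /subnK <-.
elim: (N' - N)%N => [//|i <-]; rewrite addSn.
apply: riemann_sum_refine; apply: saturated_le sU; exact: leq_addl.
Qed.

Lemma riemann_limit_ball N a : (a < M N)%N ->
  riemann_limit (Xball p d N a) = f N a.
Proof.
move=> aM; rewrite (@riemann_limit_saturated N); last first.
  by move=> x y; rewrite /Xball /= => ->.
have ptE b : (b < M N)%N -> `[< Xball p d N a (pt b) >] = (b == a).
  move=> bM; have := nat_in_XE d_gt0 p_gt0 b N; rewrite modn_small // => ptb.
  by apply/asboolP/eqP => [|<-//]; rewrite /Xball -[in X in _ -> X]ptb.
rewrite /riemann_sum big_nat_cond.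
rewrite (eq_bigl (fun b => (0 <= b < M N)%N && (b == a))).
  by rewrite -big_nat_cond big_nat1_eq aM.
by move=> b; case: (boolP (b < M N)%N) => //= bM; rewrite ptE.
Qed.

(** At a level that saturates all the [U i], the Riemann sums themselves are
    additive, since an integer lies in at most one [U i]. *)
Lemma riemann_limit_distribution : is_distribution riemann_limit.
Proof.
move=> m U coU tU.
have /choice[N_ satU_] := fun i => compact_open_saturated (coU i).
pose N0 := (\max_i N_ i)%N.
have satU i : saturated N0 (U i).
  by apply: saturated_le (satU_ i); exact: leq_bigmax.
rewrite (@riemann_limit_saturated N0); last first.
  by move=> x y xy; split=> -[i _ Ui]; exists i => //; apply/(satU i _ _ xy).
under eq_bigr => i _ do rewrite (riemann_limit_saturated (satU i)).
rewrite /riemann_sum; under eq_bigr => i _ do rewrite big_mkcond /=.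
rewrite exchange_big big_mkcond /=; apply: eq_bigr => a _.
case: asboolP => [[i _ Uia]|nU].
  rewrite (bigD1 i) //= asboolT // big1 ?addr0 // => j ji.
  case: asboolP => // Uja.
  by rewrite (tU i j) ?eqxx // in ji; exists (pt a).
rewrite big1 // => i _; case: asboolP => // Uia.
by case: nU; exists i.
Qed.

End RiemannSums.

(** * The q-integers *)

Section QIntegers.
Variable K : fieldType.
Implicit Types (q Q : K) (m n : nat).

Lemma qnat0 Q : qnat Q 0 = 0.
Proof. by rewrite /qnat /qnum expr0 subrr mul0r; case: ifP. Qed.

Lemma qnatS Q n : qnat Q n.+1 = 1 + Q * qnat Q n.
Proof.
rewrite /qnat /qnum; case: eqVneq => [->|Q1]; first by rewrite mul1r mulrS.
have Q1' : 1 - Q != 0 by rewrite subr_eq0 eq_sym.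
by rewrite exprS; field.
Qed.

Lemma qnatD Q m n : qnat Q (m + n) = qnat Q m + Q ^+ m * qnat Q n.
Proof.
elim: m => [|m IH]; first by rewrite qnat0 add0r mul1r.
by rewrite addSn !qnatS IH exprS; ring.
Qed.

Lemma qnatM Q m n : qnat Q (m * n) = qnat Q m * qnat (Q ^+ m) n.
Proof.
elim: n => [|n IH]; first by rewrite muln0 !qnat0 mulr0.
by rewrite mulnS qnatD IH qnatS; ring.
Qed.

Lemma qnat_subX1 Q n : (Q - 1) * qnat Q n = Q ^+ n - 1.
Proof.
elim: n => [|n IH]; first by rewrite qnat0 expr0 mulr0 subrr.
by rewrite qnatS mulrDr mulrCA IH exprS; ring.
Qed.

End QIntegers.

(** * The functional defined by the q-Bernoulli numbers *)

Section UmbralCalculus.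
Variable K : fieldType.
Implicit Types (q : K) (b : nat -> K) (P E : {poly K}) (alpha : nat).

(** The umbral evaluation, which reads [X ^ l] as [b l]. *)
Definition moment b P : K := \sum_(l < size P) P`_l * b l.

Lemma moment_wide b P n : (size P <= n)%N ->
  moment b P = \sum_(l < n) P`_l * b l.
Proof.
move=> Pn; rewrite /moment (big_ord_widen n (fun l => P`_l * b l)) //.
rewrite big_mkcond; apply: eq_bigr => l _; case: ltnP => // lP.
by rewrite nth_default ?mul0r.
Qed.

Fact moment_is_scalar b : scalar (moment b).
Proof.
move=> c P E; set n := maxn (size P) (size E).
have sn : (size (c *: P + E)%R <= n)%N.
  rewrite (leq_trans (size_polyD _ _)) // geq_max !leq_max leqnn orbT andbT.
  by rewrite size_scale_leq.
rewrite (moment_wide b sn) (moment_wide b (leq_maxl _ _ : (_ <= n)%N)).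
rewrite (moment_wide b (leq_maxr _ _ : (_ <= n)%N)) mulr_sumr -big_split /=.
by apply: eq_bigr => l _; rewrite coefD coefZ; ring.
Qed.

HB.instance Definition _ b :=
  GRing.isLinear.Build K {poly K} K *%R (moment b) (moment_is_scalar b).

Lemma momentXn b n : moment b 'X^n = b n.
Proof.
rewrite (@moment_wide _ _ n.+1) ?size_polyXn // big_ord_recr /= coefXn eqxx.
rewrite mul1r big1 ?add0r // => i _.
by rewrite coefXn (ltn_eqF (ltn_ord i)) mul0r.
Qed.

(** In umbral notation, with [b ^ l] read as [b l], the left-hand side of the
    recursion of index [n] is this operator applied to [X ^ n]. *)
Definition qshift alpha q P : {poly K} :=
  q *: (P \Po (q ^+ alpha *: 'X + 1)) - P.

Fact qshift_is_linear alpha q : linear (qshift alpha q).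
Proof.
move=> c P E; rewrite /qshift linearP /= scalerDr scalerBr !scalerA (mulrC q).
by rewrite opprD addrACA.
Qed.

HB.instance Definition _ alpha q :=
  GRing.isLinear.Build K {poly K} {poly K} *:%R (qshift alpha q)
    (qshift_is_linear alpha q).

(** The right-hand side of the recursion extended linearly from [X ^ n] to all
    polynomials, the case [n = 0] being dictated by [b 0 = 1]. *)
Definition qjump alpha q P : K :=
  (q - 1) * P`_0 + alpha%:R / qnat q alpha * P`_1.

Fact qjump_is_scalar alpha q : scalar (qjump alpha q).
Proof. by move=> c P E; rewrite /qjump !coefD !coefZ; ring. Qed.

HB.instance Definition _ alpha q :=
  GRing.isLinear.Build K {poly K} K *%R (qjump alpha q)
    (qjump_is_scalar alpha q).

Lemma qshiftXn alpha q n : qshift alpha q 'X^n =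
  q *: (\sum_(l < n.+1) ('C(n, l)%:R * q ^+ (alpha * l)) *: 'X^l) - 'X^n.
Proof.
rewrite /qshift comp_Xn_poly exprD1n; congr (_ *: _ - _); apply: eq_bigr => l _.
by rewrite exprZn -exprM mulr_natl scalerMnl.
Qed.

Lemma coef_qshiftXn alpha q n i : (qshift alpha q 'X^n)`_i =
  q * ('C(n, i)%:R * q ^+ (alpha * i)) - (i == n)%:R.
Proof.
rewrite qshiftXn -(poly_def n.+1 (fun l => 'C(n, l)%:R * q ^+ (alpha * l))).
rewrite coefB coefZ coefXn coef_poly ltnS.
by case: ltnP => // ni; rewrite bin_small // mul0r.
Qed.

Lemma moment_qshiftXn alpha q b n : moment b (qshift alpha q 'X^n) =
  q * (\sum_(l < n.+1) 'C(n, l)%:R * q ^+ (alpha * l) * b l) - b n.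
Proof.
rewrite qshiftXn linearB linearZ linear_sum /= momentXn; congr (_ * _ - _).
by apply: eq_bigr => l _; rewrite linearZ /= momentXn.
Qed.

Lemma qjumpXn alpha q n : qjump alpha q 'X^n =
  (q - 1) * (n == 0%N)%:R + alpha%:R / qnat q alpha * (n == 1%N)%:R.
Proof. by rewrite /qjump !coefXn ![_ == n]eq_sym. Qed.

Lemma moment_qshift alpha q b P : qBernoulli_rec alpha q b ->
  moment b (qshift alpha q P) = qjump alpha q P.
Proof.
move=> [b0 brec]; rewrite -[P]coefK poly_def !linear_sum /=.
apply: eq_bigr => -[n _] _ /=; rewrite !linearZ /=; congr (_ * _).
rewrite moment_qshiftXn qjumpXn; case: n => [|n].
  by rewrite big_ord1 muln0 expr0 bin0 b0 /=; ring.
by rewrite brec // mulr0 add0r; case: eqP => _; rewrite ?mulr1 ?mulr0.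
Qed.

Definition one_or_nonroot q : Prop :=
  q = 1 \/ forall n : nat, (0 < n)%N -> q ^+ n != 1.

Hypothesis K0 : [pchar K] =i pred0.

Let natK n : (n%:R == 0 :> K) = (n == 0%N).
Proof. by have /pcharf0P := K0. Qed.

(** The operator is triangular in the basis of monomials. Its diagonal entries
    [q ^ (alpha n + 1) - 1] vanish only if [q = 1], when it is the forward
    difference, which lowers degrees by one with leading factor the degree. *)
Lemma qshift_surj alpha q P : one_or_nonroot q ->
  exists E, qshift alpha q E = P.
Proof.
move=> qP.
have topE n : exists E : {poly K}, (size (qshift alpha q E) <= n.+1)%N /\
    (qshift alpha q E)`_n != 0.
  case: qP => [->|qn]; [exists 'X^(n.+1)|exists 'X^n];
    rewrite coef_qshiftXn; split.
  - apply/leq_sizeP => i ni; rewrite coef_qshiftXn expr1n !mul1r mulr1.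
    move: ni; rewrite leq_eqVlt => /predU1P[<-|ni].
      by rewrite eqxx binn subrr.
    by rewrite bin_small // (gtn_eqF ni) subrr.
  - by rewrite expr1n !mul1r mulr1 (ltn_eqF (ltnSn n)) binSn subr0 natK.
  - apply/leq_sizeP => i ni; rewrite coef_qshiftXn bin_small // (gtn_eqF ni).
    by rewrite mul0r mulr0 subrr.
  - by rewrite eqxx binn mul1r -exprS subr_eq0 qn.
have [n] := ubnP (size P); elim: n => // n IH in P *; rewrite ltnS => Pn.
case: n Pn IH => [|n] Pn IH.
  by exists 0; rewrite linear0; apply/esym/eqP; rewrite -size_poly_leq0.
have [E [sE E0]] := topE n.
pose c := P`_n / (qshift alpha q E)`_n.
have [|E' E'P] := IH (P - c *: qshift alpha q E).
  rewrite ltnS; apply/leq_sizeP => i; rewrite leq_eqVlt => /predU1P[<-|ni].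
    by rewrite coefB coefZ /c divfK // subrr.
  rewrite coefB coefZ !nth_default ?mulr0 ?subrr //.
    exact: leq_trans sE ni.
  exact: leq_trans Pn ni.
by exists (E' + c *: E); rewrite linearD linearZ /= E'P subrK.
Qed.

(** For [q <> 1] the triangular operator is injective; for [q = 1] its kernel
    consists of the constants, on which [qjump] vanishes. This makes the value
    of [qjump] on a preimage under [qshift] well defined. *)
Lemma qshift_ker alpha q P : one_or_nonroot q ->
  qshift alpha q P = 0 -> qjump alpha q P = 0.
Proof.
move=> qP DP0.
have D0 i : \sum_(j < size P)
    P`_j * (q * ('C(j, i)%:R * q ^+ (alpha * i)) - (i == j)%:R) = 0.
  have DPi : (qshift alpha q P)`_i = 0 by rewrite DP0 coef0.
  rewrite -[RHS]DPi -[P in RHS]coefK poly_def linear_sum coef_sum.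
  by apply: eq_bigr => j _; rewrite linearZ coefZ coef_qshiftXn.
have [->|P0] := eqVneq P 0; first by rewrite linear0.
have [s sP] : exists s, size P = s.+1.
  by exists (size P).-1; rewrite prednK ?size_poly_gt0.
have lP : P`_s != 0 by rewrite -[s]/(s.+1.-1) -sP -lead_coefE lead_coef_eq0.
case: qP => [q1|qn].
  case: s sP lP => [|m] sP lP.
    rewrite /qjump q1 subrr mul0r (nth_default _ (_ : (size P <= 1)%N)) ?sP //.
    by rewrite mulr0 addr0.
  move: (D0 m); rewrite sP !big_ord_recr /= big1 => [|i _]; last first.
    by rewrite bin_small // (gtn_eqF (ltn_ord i)) mul0r mulr0 subrr mulr0.
  rewrite q1 expr1n !mul1r !mulr1 binn eqxx subrr mulr0 !add0r binSn.
  rewrite (ltn_eqF (ltnSn m)) subr0 => /eqP.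
  by rewrite mulf_eq0 (negPf lP) natK.
move: (D0 s); rewrite sP big_ord_recr /= big1 => [|i _]; last first.
  by rewrite bin_small // (gtn_eqF (ltn_ord i)) mul0r mulr0 subrr mulr0.
rewrite binn eqxx mul1r add0r -exprS => /eqP.
by rewrite mulf_eq0 (negPf lP) subr_eq0 (negPf (qn _ _)).
Qed.

Lemma one_or_nonrootX q n : one_or_nonroot q -> (0 < n)%N ->
  one_or_nonroot (q ^+ n).
Proof.
case=> [->|qn] n0; [left; exact: expr1n | right=> m m0].
by rewrite -exprM qn // muln_gt0 n0.
Qed.

Lemma qnat_neq0 q n : one_or_nonroot q -> (0 < n)%N -> qnat q n != 0.
Proof.
move=> qP n0; rewrite /qnat /qnum; case: (eqVneq q 1) => [_|q1].
  by rewrite natK -lt0n.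
case: qP => [/eqP|qn]; first by rewrite (negPf q1).
by rewrite mulf_neq0 ?invr_eq0 // subr_eq0 eq_sym // qn.
Qed.

(** A solution is obtained by sending [X ^ n] to the value of [qjump] on any
    preimage of [X ^ n] under [qshift]. *)
Lemma qBernoulliP alpha q : one_or_nonroot q -> (0 < alpha)%N ->
  qBernoulli_rec alpha q (qBernoulli alpha q).
Proof.
move=> qP alpha0; suff [b bP] : exists b, qBernoulli_rec alpha q b.
  rewrite /qBernoulli; case: xgetP => [b' _ //|/(_ b)]; exact.
have /choice[E EP] : forall n, exists E, qshift alpha q E = 'X^n.
  by move=> n; apply: qshift_surj.
pose b n := qjump alpha q (E n); exists b.
have bP P : moment b (qshift alpha q P) = qjump alpha q P.
  pose G : {poly K} :=
    \sum_(l < size (qshift alpha q P)) (qshift alpha q P)`_l *: E l.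
  have GP : qshift alpha q (G - P) = 0.
    apply/eqP; rewrite linearB subr_eq0 linear_sum /=; apply/eqP.
    rewrite -[RHS]coefK poly_def; apply: eq_bigr => l _.
    by rewrite linearZ /= EP.
  have /eqP := qshift_ker qP GP; rewrite linearB subr_eq0 /= => /eqP <-.
  by rewrite linear_sum; apply: eq_bigr => l _; rewrite linearZ.
split=> [|n n0]; last first.
  rewrite -moment_qshiftXn bP qjumpXn (gtn_eqF n0) mulr0 add0r.
  by case: eqP => _; rewrite ?mulr1 ?mulr0.
(* The value at 0 follows from P = X when q = 1, and from P = 1 otherwise. *)
have [q1|q1] := eqVneq q 1.
  have := bP 'X^1; rewrite moment_qshiftXn qjumpXn !big_ord_recr big_ord0 /=.
  rewrite bin0 binn q1 subrr !expr1n !mul1r add0r addrK mul0r add0r mulr1.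
  by rewrite /qnat /qnum eqxx divff // natK -lt0n.
have := bP 'X^0; rewrite moment_qshiftXn qjumpXn big_ord1 /=.
rewrite muln0 expr0 bin0 !mul1r mulr0 addr0 mulr1 -{2}[b 0%N]mul1r -mulrBl.
by move=> e; apply: (mulfI (_ : q - 1 != 0)); rewrite ?subr_eq0 // e mulr1.
Qed.

(** The recursion is solved for [b n], whose coefficient is the integer [n + 1]
    when [q = 1] and [q ^ (alpha n + 1) - 1] otherwise. *)
Lemma qBernoulli_rational alpha q (S : divringClosed K) n : one_or_nonroot q ->
  (0 < alpha)%N -> q \in S -> qBernoulli alpha q n \in S.
Proof.
move=> qP alpha0 qS; have [b0 brec] := qBernoulliP qP alpha0.
move: b0 brec; set b := qBernoulli _ _ => b0 brec.
elim/ltn_ind: n => -[_|n IH]; first by rewrite b0 rpred1.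
have rhsS m : (if m == 1%N then alpha%:R / qnat q alpha else 0) \in S.
  case: ifP => _; rewrite ?rpred0 // rpred_div ?rpred_nat // /qnat /qnum.
  by case: ifP => _; rewrite ?rpred_nat // rpred_div ?rpredB ?rpredX ?rpred1.
have lowS m : \sum_(l < n.+1) 'C(m, l)%:R * q ^+ (alpha * l) * b l \in S.
  by apply: rpred_sum => l _; rewrite !rpredM ?rpredX ?rpred_nat ?IH.
case: qP => [q1|qn].
  (* For q = 1 the terms of index n + 2 cancel in the relation n + 2. *)
  have := brec n.+2 isT.
  rewrite 2!big_ord_recr /= binn binSn q1 !expr1n !mul1r !mulr1 addrK.
  move=> /(canRL (addKr _)) e.
  have n0 : n.+2%:R != 0 :> K by rewrite natK.
  rewrite -[b _](mulKf n0) e mulrC rpred_div ?rpred_nat //.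
  have := lowS n.+2; rewrite q1 => low.
  by rewrite addr0 rpredN.
have := brec n.+1 isT; rewrite big_ord_recr /= binn mul1r => e.
have qn0 : q * q ^+ (alpha * n.+1) - 1 != 0 by rewrite -exprS subr_eq0 qn.
have {e} e : (q * q ^+ (alpha * n.+1) - 1) * b n.+1 =
    (if n.+1 == 1%N then alpha%:R / qnat q alpha else 0) -
    q * (\sum_(l < n.+1) 'C(n.+1, l)%:R * q ^+ (alpha * l) * b l).
  by rewrite -e; ring.
rewrite -[b _](mulKf qn0) e mulrC rpred_div ?rpredB ?rpredM ?rpredX ?rpred1 //.
Qed.

Definition affine (u v : K) : {poly K} := u%:P + v *: 'X.

(** Since [qshift] is onto, both sides need only be compared on
    [P = qshift alpha q E]. With [u i] the [i]-th affine polynomial,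
    [Q u_i + 1 = u_(i+1)], so that the right-hand side telescopes; its two end
    terms combine into [qshift] for [q ^ n] applied to [E([n]_Q X)]. *)
Theorem qBernoulli_multiplication alpha q n P :
  one_or_nonroot q -> (0 < alpha)%N -> (0 < n)%N ->
  moment (qBernoulli alpha q) P = (qnat q n)^-1 * \sum_(0 <= i < n) q ^+ i *
    moment (qBernoulli alpha (q ^+ n))
      (P \Po affine (qnat (q ^+ alpha) i)
                    (q ^+ (alpha * i) * qnat (q ^+ alpha) n)).
Proof.
move=> qP alpha0 n0; have [E <-] := @qshift_surj alpha q P qP.
rewrite moment_qshift; last exact: qBernoulliP.
set b := qBernoulli alpha (q ^+ n); set Q := q ^+ alpha.
pose u i := affine (qnat Q i) (q ^+ (alpha * i) * qnat Q n).
pose G i := q ^+ i * moment b (E \Po u i).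
have uS i : (Q *: 'X + 1) \Po u i = u i.+1.
  rewrite comp_polyD comp_polyZ comp_polyX comp_polyC /u /affine qnatS mulnS.
  by rewrite exprD -/Q -!mul_polyC !polyCD !polyCM; ring.
have step i : q ^+ i * moment b (qshift alpha q E \Po u i) = G i.+1 - G i.
  rewrite /qshift comp_polyB comp_polyZ -comp_polyA uS linearB linearZ /= /G.
  by rewrite exprS; ring.
under eq_big_nat => i _ do rewrite step.
rewrite telescope_sumr //.
pose E' := E \Po (qnat Q n *: 'X).
have -> : G n - G 0 = moment b (qshift alpha (q ^+ n) E').
  rewrite /qshift linearB linearZ /= /E' -comp_polyA /G expr0 mul1r.
  congr (_ * moment _ (_ \Po _) - moment _ (_ \Po _)); last first.
    by rewrite /u /affine qnat0 muln0 expr0 mul1r add0r.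
  rewrite comp_polyZ comp_polyX /u /affine -exprM (mulnC n).
  by rewrite -!mul_polyC !polyCM; ring.
rewrite moment_qshift; last exact/qBernoulliP/alpha0/one_or_nonrootX.
rewrite /qjump; have coefE' i : E'`_i = qnat Q n ^+ i * E`_i.
  rewrite /E' comp_polyE; under eq_bigr => j _ do rewrite exprZn scalerA.
  rewrite -(poly_def _ (fun j => E`_j * qnat Q n ^+ j)) coef_poly mulrC.
  by case: ltnP => // si; rewrite nth_default ?mulr0.
rewrite !coefE' expr0 expr1 mul1r.
have qn0 : qnat q n != 0 by exact: qnat_neq0.
have qna0 : qnat (q ^+ n) alpha != 0.
  by apply: qnat_neq0 => //; exact: one_or_nonrootX.
have qa0 : qnat q alpha != 0 by exact: qnat_neq0.
have qnaE : qnat q alpha * qnat Q n = qnat q n * qnat (q ^+ n) alpha.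
  by rewrite -!qnatM mulnC.
have -> : qnat Q n = qnat q n * qnat (q ^+ n) alpha / qnat q alpha.
  by rewrite -qnaE mulrC mulKf.
rewrite -qnat_subX1; field.
by rewrite qn0 qna0 qa0.
Qed.

End UmbralCalculus.

(** * The values on balls *)

Section Balls.
Variables (K : fieldType) (p d alpha k : nat) (q : K).
Hypotheses (K0 : [pchar K] =i pred0) (qP : one_or_nonroot q).
Hypotheses (p_gt0 : (0 < p)%N) (d_gt0 : (0 < d)%N) (alpha_gt0 : (0 < alpha)%N).

Let Q := q ^+ alpha.
Let M N := (d * p ^ N)%N.

(** The q-analogue of the parametrization [a + m X] of the ball. *)
Definition affine_ball m a : {poly K} :=
  affine (qnat Q a) (Q ^+ a * qnat Q m).

(** The q-number of [a / m] in base [Q ^ m] is [[a]_Q / [m]_Q], so the binomial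
    sum becomes the expansion of a [k]-th power. *)
Lemma qBernoulli_polyE m a : (0 < m)%N ->
  qnat Q m ^+ k * qBernoulli_poly alpha (q ^+ m) k (q ^+ a) (a%:R / m%:R) =
  moment (qBernoulli alpha (q ^+ m)) (affine_ball m a ^+ k).
Proof.
move=> m0.
have QP : one_or_nonroot Q by exact: one_or_nonrootX.
have aE : qnum ((q ^+ m) ^+ alpha) ((q ^+ a) ^+ alpha) (a%:R / m%:R) *
    qnat Q m = qnat Q a.
  rewrite -!exprM ![(_ * alpha)%N]mulnC !exprM -/Q /qnat /qnum.
  case: QP => [->|QP].
    by rewrite !expr1n eqxx divfK //; have /pcharf0P-> := K0; rewrite -lt0n.
  have Q1 : Q != 1 by rewrite -[Q]expr1 QP.
  rewrite (negPf Q1) (negPf (QP _ m0)) mulrA divfK // subr_eq0 eq_sym.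
  exact: QP.
rewrite /affine_ball /affine exprDn linear_sum /qBernoulli_poly mulr_sumr.
apply: eq_bigr => l _.
rewrite exprZn -polyC_exp mul_polyC scalerA -scaler_nat scalerA linearZ /=.
rewrite momentXn -aE.
have -> : qnat Q m ^+ k = qnat Q m ^+ (k - l) * qnat Q m ^+ l.
  by rewrite -exprD subnK // -ltnS.
have -> : (q ^+ a) ^+ (alpha * l) = (Q ^+ a) ^+ l.
  by rewrite /Q -!exprM; congr (_ ^+ _); rewrite mulnCA mulnA.
by rewrite !exprMn; ring.
Qed.

Lemma mu_ballE N a : mu_ball p d alpha k q N a = (qnat q (M N))^-1 * q ^+ a *
  moment (qBernoulli alpha (q ^+ M N)) (affine_ball (M N) a ^+ k).
Proof.
rewrite -qBernoulli_polyE; first by rewrite /mu_ball -/(M N) -/Q; ring.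
by rewrite muln_gt0 d_gt0 expn_gt0 p_gt0.
Qed.

(** The parametrization of a ball, composed with that of its [i]-th part, is the
    parametrization of the ball around [a + i d p ^ N] of the next level. *)
Lemma mu_ball_split N a :
  mu_ball p d alpha k q N a =
  \sum_(0 <= i < p) mu_ball p d alpha k q N.+1 (a + i * M N).
Proof.
have M0 : (0 < M N)%N by rewrite muln_gt0 d_gt0 expn_gt0 p_gt0.
have MS : M N.+1 = (M N * p)%N by rewrite /M expnSr mulnA.
rewrite mu_ballE (@qBernoulli_multiplication _ K0 _ (q ^+ M N) p) //; last first.
  exact: one_or_nonrootX.
rewrite !mulr_sumr; apply: eq_big_nat => i _.
rewrite mu_ballE MS -exprM qnatM invfM.
have -> : (q ^+ M N) ^+ alpha = Q ^+ M N by rewrite -!exprM mulnC.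
have -> : (q ^+ M N) ^+ (alpha * i) = (Q ^+ M N) ^+ i.
  by rewrite -!exprM; congr (_ ^+ _); rewrite mulnCA mulnA.
have -> : (affine_ball (M N) a ^+ k) \Po affine (qnat (Q ^+ M N) i)
    ((Q ^+ M N) ^+ i * qnat (Q ^+ M N) p) =
    affine_ball (M N * p) (a + i * M N) ^+ k.
  rewrite rmorphXn /=; congr (_ ^+ k).
  rewrite /affine_ball /affine comp_polyD comp_polyC comp_polyZ comp_polyX.
  rewrite (mulnC i) qnatD !qnatM exprD exprM.
  by rewrite -!mul_polyC !polyCD !polyCM; ring.
by rewrite exprD (mulnC i) !exprM; ring.
Qed.

Lemma mu_ball_rational (S : divringClosed K) N a : q \in S ->
  mu_ball p d alpha k q N a \in S.
Proof.
move=> qS.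
have M0 : (0 < M N)%N by rewrite muln_gt0 d_gt0 expn_gt0 p_gt0.
have qnumS (x y z : K) : x \in S -> y \in S -> z \in S -> qnum x y z \in S.
  move=> *; rewrite /qnum; case: ifP => // _.
  by rewrite rpred_div ?rpredB ?rpred1.
have qnatS x n : x \in S -> qnat x n \in S.
  by move=> xS; rewrite qnumS ?rpredX ?rpred_nat.
rewrite /mu_ball -/(M N) !rpredM ?rpredX ?rpredV ?qnatS ?rpredX //.
apply: rpred_sum => l _; rewrite !rpredM ?rpredX ?rpred_nat ?qnumS ?rpredX //.
  by rewrite rpred_div ?rpred_nat.
by apply: qBernoulli_rational; rewrite ?rpredX //; exact: one_or_nonrootX.
Qed.

End Balls.

(** * Roots of unity near 1 *)

Section Ultrametric.
Variables (R : realType) (K : fieldType) (w : K -> R).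
Hypothesis wP : is_absolute_value w.

Lemma absv1 : w 1 = 1.
Proof.
have [_ w0 wM _] := wP.
have w1 : w 1 != 0 by apply/eqP => /w0/eqP; rewrite oner_eq0.
by apply: (mulfI w1); rewrite -wM !mulr1.
Qed.

Lemma absvN x : w (- x) = w x.
Proof.
have [w_ge0 _ wM _] := wP; apply/eqP.
rewrite -(eqrXn2 (_ : 0 < 2)%N) // !expr2 -!wM mulrNN //.
Qed.

Lemma absv_one_unit (x : K) n : w (1 - x) < 1 -> w (1 - x ^+ n) < 1.
Proof.
have [w_ge0 w0 wM wD] := wP => x1.
have wx : w x <= 1.
  have -> : x = 1 + - (1 - x) by ring.
  by rewrite (le_trans (wD _ _)) // absvN absv1 ge_max lexx ltW.
elim: n => [|n IH]; first by rewrite subrr (w0 0).2.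
have -> : 1 - x ^+ n.+1 = (1 - x) + x * (1 - x ^+ n) by rewrite exprS; ring.
rewrite (le_lt_trans (wD _ _)) // gt_max x1 wM (le_lt_trans _ IH) //.
by rewrite ler_piMl.
Qed.

(** If [x] were not 1, the sum of the [x ^ i] for [i < m] would be 0; its terms
    are close to 1, so it is also close to [m], which is a unit. *)
Lemma root_of_unity_near1 (x : K) m : w m%:R = 1 -> w (1 - x) < 1 ->
  x ^+ m = 1 -> x = 1.
Proof.
have [w_ge0 w0 wM wD] := wP => wm x1 xm; apply/eqP; apply: contraT => nx1.
have sum0 : \sum_(i < m) x ^+ i = 0.
  apply: (mulfI (_ : x - 1 != 0)); rewrite ?subr_eq0 //.
  by rewrite -subrX1 xm subrr mulr0.
suff : w m%:R < 1 by rewrite wm ltxx.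
have -> : m%:R = \sum_(i < m) (1 - x ^+ i).
  by rewrite sumrB sum0 subr0 sumr_const card_ord.
apply: (big_ind (fun y => w y < 1)) => [|y z y1 z1|i _].
- by rewrite (w0 0).2.
- by rewrite (le_lt_trans (wD _ _)) // gt_max y1.
- exact: absv_one_unit.
Qed.

(** If [q ^ (p ^ s m) = 1] with [m] prime to [p], then [q ^ (p ^ s)] is an
    [m]-th root of unity near 1, hence equal to 1, and the denominator
    [[d p ^ s]_q] vanishes unless [q = 1]. *)
Lemma one_or_nonroot_near1 (p d : nat) (q : K) : prime p ->
  (forall m, coprime p m -> w m%:R = 1) -> w (1 - q) < 1 ->
  (forall N, qnat q (d * p ^ N) != 0) -> one_or_nonroot q.
Proof.
move=> p_pr wp q1 qn0; have [->|nq1] := eqVneq q 1; [by left | right].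
move=> n n0; apply/eqP => qn1.
have [m pm nE] := pfactor_coprime p_pr n0; set s := logn p n in nE.
have qps : q ^+ (p ^ s) = 1.
  apply: (@root_of_unity_near1 _ m); [exact: wp | exact: absv_one_unit |].
  by rewrite -exprM mulnC -nE.
have /eqP[] := qn0 s; rewrite /qnat /qnum (negPf nq1) mulnC exprM qps expr1n.
by rewrite subrr mul0r.
Qed.

End Ultrametric.

(** The embeddings of the rationals into the successive extensions preserve the
    absolute value, so it suffices to look at integers inside the rationals. *)
Lemma is_Cp_ultrametric (R : realType) p (K : fieldType) (w : K -> R) : prime p ->
  is_Cp p w -> [/\ is_absolute_value w, [pchar K] =i pred0 &
    forall m, coprime p m -> w m%:R = 1].
Proof.
move=> p_pr [Qp [vQp [i [Qpbar [vL [j [h]]]]]]].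
case=> -[_ _ vi _] _ _ vj [wP _ wh _].
have hji r : w (h (j (i r))) = padic_abs R p r by rewrite wh vj vi.
split=> // [|m pm].
  apply/pcharf0P => n; rewrite -(rmorph_nat h) -(rmorph_nat j) -(rmorph_nat i).
  by rewrite !fmorph_eq0 pnatr_eq0.
rewrite -(rmorph_nat h) -(rmorph_nat j) -(rmorph_nat i) hji /padic_abs.
have m0 : (0 < m)%N.
  by case: m pm => //; rewrite /coprime gcdn0 => /eqP p1; rewrite p1 in p_pr.
rewrite pnatr_eq0 (gtn_eqF m0) (pmulrn (1 : rat)) denq_int numq_int.
rewrite absz1 absz_nat logn1.
by rewrite logn_coprime // expr0 divr1.
Qed.

(** * The distribution *)

Theorem theorem3 (R : realType) (p : nat) (p_prime : prime p)
    (Cp : fieldType) (abs : Cp -> R) (CpP : is_Cp p abs)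
    (q : Cp) (q_near1 : abs (1 - q) < 1)
    (alpha k d : nat) (alpha_gt0 : (0 < alpha)%N) (pd_coprime : coprime p d)
    (den_neq0 : forall N : nat, qnat q (d * p ^ N) != 0) :
  exists mu : set (X p d) -> Cp,
    [/\ forall N a : nat, (a < d * p ^ N)%N ->
          mu (Xball p d N a) = mu_ball p d alpha k q N a,
        is_distribution mu &
        forall U : set (X p d), is_compact_open U -> rat_adjoin q (mu U)].
Proof.
have [absP K0 abs_coprime] := is_Cp_ultrametric p_prime CpP.
have qP := one_or_nonroot_near1 absP p_prime abs_coprime q_near1 den_neq0.
have p_gt0 := prime_gt0 p_prime.
have d_gt0 : (0 < d)%N.
  by rewrite lt0n; apply/eqP => d0; have := den_neq0 0%N; rewrite d0 qnat0 eqxx.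
have split N a : (a < d * p ^ N)%N -> mu_ball p d alpha k q N a =
    \sum_(0 <= i < p) mu_ball p d alpha k q N.+1 (a + i * (d * p ^ N)).
  by move=> _; exact: mu_ball_split.
exists (riemann_limit p_gt0 d_gt0 (mu_ball p d alpha k q)); split.
- by move=> N a aN; exact: riemann_limit_ball.
- exact: riemann_limit_distribution.
- move=> U coU S clS _ qS.
  pose S' : divringClosed Cp :=
    HB.pack S (GRing.isDivringClosed.Build Cp S clS).
  have [N satU] := compact_open_saturated coU.
  rewrite (riemann_limit_saturated p_gt0 d_gt0 split satU).
  suff : riemann_sum p_gt0 d_gt0 (mu_ball p d alpha k q) N U \in S' by [].
  by apply: rpred_sum => a _; exact: mu_ball_rational.
Qed.
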